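(* Let $n\ge2$, $r\in\mathbb Z_n$, $\mathsf V=\mathsf V(2,r)$, $\lambda_r=q^{-r(r+1)}$, $\xi=-(q^{1/2}+q^{-1/2})$, and $k\ge2$. Then there is an algebra homomorphism $\pi:\mathsf{TL}_k(\xi)\to\mathrm{End}_{\mathsf D_n}(\mathsf V^{\otimes k})$ with $\pi(\mathsf t_i)=q^{1/2}(\lambda_r^{-1}\check{\mathsf R}_i-\mathrm{id})$ for $1\le i\le k-1$, and $\pi$ is injective.
   Context: $\mathbb k$ algebraically closed of characteristic zero, $n\ge2$, $q\in\mathbb k$ a primitive $n$th root of unity; fix a square root $q^{1/2}\in\mathbb k$ and put $q^{-1/2}=(q^{1/2})^{-1}$. $\mathsf D_n$ is the Hopf algebra generated by $a,b,c,d$ with relations $ba=qab$, $db=qbd$, $bc=cb$, $ca=qac$, $dc=qcd$, $da-qad=1-bc$, $a^n=d^n=0$, $b^n=c^n=1$ and $\Delta(a)=a\otimes b+1\otimes a$, $\Delta(d)=d\otimes c+1\otimes d$, $\Delta(b)=b\otimes b$, $\Delta(c)=c\otimes c$. For $1\le\ell\le n$, $s\in\mathbb Z_n$, $\mathsf V(\ell,s)$ is the module with basis $v_1,\dots,v_\ell$ and action $a.v_j=v_{j+1}$ ($j<\ell$), $a.v_\ell=0$, $b.v_j=q^{s+j-1}v_j$, $c.v_j=q^{j-(s+\ell)}v_j$, $d.v_1=0$, $d.v_j=\alpha_{j-1}(\ell)v_{j-1}$ ($j>1$), $\alpha_i(\ell)=\frac{(q^i-1)(1-q^{i-\ell})}{q-1}$.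 With $[m]=1+q+\dots+q^{m-1}$, $[m]!=[m]\cdots[1]$, $[0]!=1$, the R-matrix is $\mathcal R=\frac1n\sum_{m,s,t=0}^{n-1}\frac{q^{-tm}}{[s]!}a^sb^t\otimes c^md^s$. $\mathsf R$ is the action of $\mathcal R$ on $\mathsf V\otimes\mathsf V$ ($a^sb^t$ on the first factor), $\sigma$ the flip, $\check{\mathsf R}=\sigma\mathsf R$, and $\check{\mathsf R}_i=\mathrm{id}^{\otimes(i-1)}\otimes\check{\mathsf R}\otimes\mathrm{id}^{\otimes(k-i-1)}$ on $\mathsf V^{\otimes k}$. The Temperley–Lieb algebra $\mathsf{TL}_k(\xi)$ is the $\mathbb k$-algebra with generators $\mathsf t_1,\dots,\mathsf t_{k-1}$ and relations $\mathsf t_i\mathsf t_j=\mathsf t_j\mathsf t_i$ ($|i-j|>1$), $\mathsf t_i\mathsf t_{i+1}\mathsf t_i-\mathsf t_i=\mathsf t_{i+1}\mathsf t_i\mathsf t_{i+1}-\mathsf t_{i+1}$ and $\mathsf t_i\mathsf t_{i+1}\mathsf t_i=\mathsf t_i$ ($1\le i\le k-2$), $\mathsf t_i^2=\xi\mathsf t_i$ ($1\le i\le k-1$). *)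

(* Defs.v *)
From HB Require Import structures.
From mathcomp Require Import all_boot all_order all_algebra.
From mathcomp Require Import mxtens.
Set Implicit Arguments.
Unset Strict Implicit.
Unset Printing Implicit Defensive.
Import Order.TTheory GRing.Theory Num.Theory.
Local Open Scope ring_scope.

Inductive Dgen := Ga | Gb | Gc | Gd.

Section Dn.
Variable K : fieldType.
Variable q : K.

Definition alpha (i l : nat) : K :=
  (q ^+ i - 1) * (1 - q ^ (i%:Z - l%:Z)) / (q - 1).

(* The module V(l,s): matrices of a,b,c,d in the basis v_1..v_l.
   Entry (i,j) (0-based) = coefficient of v_(i+1) in x.v_(j+1). *)
Definition Vmat (l s : nat) (x : Dgen) : 'M[K]_l :=
  match x with
  | Ga => \matrix_(i, j) (i == j.+1 :> nat)%:R
  | Gb => \matrix_(i, j) ((i == j)%:R * q ^+ (s + j))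
  | Gc => \matrix_(i, j) ((i == j)%:R * q ^ ((j.+1)%:Z - (s + l)%:Z))
  | Gd => \matrix_(i, j) ((j == i.+1 :> nat)%:R * alpha i.+1 l)
  end.

Fixpoint tdim (k : nat) : nat := if k is k'.+1 then tdim k' * 2 else 1.

(* Action of the generators of D_n on V^{(x)k}, V = V(2,r), where
   V^{(x)(k+1)} = V^{(x)k} (x) V and the action is given by the coproduct
   Delta(a) = a(x)b + 1(x)a, Delta(d) = d(x)c + 1(x)d,
   Delta(b) = b(x)b, Delta(c) = c(x)c; V^{(x)0} is the trivial module
   (counit: a,d |-> 0, b,c |-> 1). *)
Fixpoint rhoT (r : nat) (k : nat) (x : Dgen) : 'M[K]_(tdim k) :=
  match k return 'M[K]_(tdim k) with
  | 0 => match x with Ga | Gd => 0 | Gb | Gc => 1%:M end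
  | k'.+1 =>
    let V := Vmat 2 r in
    match x with
    | Ga => rhoT r k' Ga *t V Gb + (1%:M : 'M_(tdim k')) *t V Ga
    | Gb => rhoT r k' Gb *t V Gb
    | Gc => rhoT r k' Gc *t V Gc
    | Gd => rhoT r k' Gd *t V Gc + (1%:M : 'M_(tdim k')) *t V Gd
    end
  end.

(* End_{D_n}(V^{(x)k}): matrices commuting with the action of D_n
   (equivalently, with the action of its generators a,b,c,d). *)
Definition isDnEnd (r k : nat) (M : 'M[K]_(tdim k)) : Prop :=
  forall x : Dgen, M *m rhoT r k x = rhoT r k x *m M.

Definition qint (m : nat) : K := \sum_(i < m) q ^+ i.
Definition qfact (m : nat) : K := \prod_(j < m) qint j.+1.

Definition Rmat (n r : nat) : 'M[K]_(2 * 2) :=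
  let V := Vmat 2 r in
  (n%:R)^-1 *: \sum_(m < n) \sum_(s < n) \sum_(t < n)
     ((q ^ (- (t * m)%:Z)) / qfact s) *:
       ((V Ga ^+ s *m V Gb ^+ t) *t (V Gc ^+ m *m V Gd ^+ s)).

Definition flipmx : 'M[K]_(2 * 2) :=
  \matrix_(i, j) (((mxtens_unindex i).1 == (mxtens_unindex j).2) &&
                  ((mxtens_unindex i).2 == (mxtens_unindex j).1))%:R.

Definition Rcheck (n r : nat) : 'M[K]_(2 * 2) := flipmx *m Rmat n r.

(* Rcheck_i = id^{(x)(i-1)} (x) Rcheck (x) id^{(x)(k-i-1)} on V^{(x)k},
   for 1 <= i <= k-1 (factors numbered 1..k). *)
Fixpoint RcheckS (n r i : nat) (k : nat) : 'M[K]_(tdim k.+1) :=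
  match k return 'M[K]_(tdim k.+1) with
  | 0 => 1%:M
  | k'.+1 =>
    if i == k'.+1 then
      castmx (mulnA _ _ _, mulnA _ _ _)
             ((1%:M : 'M_(tdim k')) *t Rcheck n r)
    else RcheckS n r i k' *t (1%:M : 'M_2)
  end.

Definition RcheckI (n r : nat) (k : nat) (i : nat) : 'M[K]_(tdim k) :=
  match k return 'M[K]_(tdim k) with
  | 0 => 1%:M
  | k'.+1 => RcheckS n r i k'
  end.

End Dn.

(* Elements are represented by noncommutative polynomial expressions   *)
(* in generators t_0..t_(m-1) (m = k-1; t_j stands for t_(j+1) of the  *)
(* paper); two expressions are equal in TL_k(xi) iff they are equal    *)
(* under every assignment of the generators into a K-algebra satisfying *)
(* the defining relations (i.e. TL_k(xi) = free algebra / ideal of the  *)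
(* relations, described by its universal property).                    *)
Inductive ncterm (K : Type) (m : nat) : Type :=
  | NGen of 'I_m
  | NScal of K
  | NAdd of ncterm K m & ncterm K m
  | NMul of ncterm K m & ncterm K m.

Arguments NGen {K m}.
Arguments NScal {K m}.
Arguments NAdd {K m}.
Arguments NMul {K m}.

Fixpoint nceval (K : fieldType) (A : algType K) (m : nat) (g : 'I_m -> A)
  (P : ncterm K m) : A :=
  match P with
  | NGen i => g i
  | NScal c => c%:A
  | NAdd P1 P2 => nceval g P1 + nceval g P2
  | NMul P1 P2 => nceval g P1 * nceval g P2
  end.

Definition TL_rel (K : fieldType) (A : algType K) (m : nat) (xi : K)
  (t : 'I_m -> A) : Prop :=
  [/\ (forall i j : 'I_m, (i.+1 < j)%N || (j.+1 < i)%N -> t i * t j = t j * t i),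
      (forall i j : 'I_m, j = i.+1 :> nat ->
          t i * t j * t i - t i = t j * t i * t j - t j),
      (forall i j : 'I_m, j = i.+1 :> nat -> t i * t j * t i = t i) &
      (forall i : 'I_m, t i * t i = xi *: t i)].

Definition TL_eq (K : fieldType) (m : nat) (xi : K) (P Q : ncterm K m) : Prop :=
  forall (A : algType K) (t : 'I_m -> A), TL_rel xi t -> nceval t P = nceval t Q.

Definition TL_hom (K : fieldType) (m N : nat) (xi : K)
  (pi : ncterm K m -> 'M[K]_N) : Prop :=
  [/\ (forall P Q, TL_eq xi P Q -> pi P = pi Q),
      (forall P Q, pi (NAdd P Q) = pi P + pi Q),
      (forall P Q, pi (NMul P Q) = pi P *m pi Q) &
      (forall c, pi (NScal c) = c%:M)].

Definition TL_inj (K : fieldType) (m N : nat) (xi : K)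
  (pi : ncterm K m -> 'M[K]_N) : Prop :=
  forall P Q, pi P = pi Q -> TL_eq xi P Q.

(* Main.v *)
Require Import Defs.
From HB Require Import structures.
From mathcomp Require Import all_boot all_order all_algebra.
From mathcomp Require Import mxtens.
From mathcomp Require Import zify ring.
Import Order.TTheory GRing.Theory Num.Theory.
Local Open Scope ring_scope.

Set Implicit Arguments.
Unset Strict Implicit.
Unset Printing Implicit Defensive.

(* Writing v_1, v_2 for the basis of V, the operator q^(1/2) (lambda^-1 Rcheck - 1) on
   V (x) V has rank one, cup o cap: it kills v_i (x) v_i and maps v_i (x) v_j (i <> j)
   to cap_coef(i) times the fixed vector
   cup_coef(1) v_1 (x) v_2 + cup_coef(2) v_2 (x) v_1, all coefficients being nonzero.
   The Temperley-Lieb relations amount to a loop value and a zigzag identity.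

   For injectivity, on k strands consider the words D_0 D_1 ... D_(k-1) with
   D_i = t_(i-1) t_(i-2) ... t_(p_i) (letters t_0, ..., t_(k-2); D_i is empty if
   p_i = i).  When p_i is only bounded by i they are, up to scalars, closed under right
   multiplication by generators; and
     D_i(p) D_(i+1)(c+2) = D_i(c) D_(i+1)(p)   for p <= c < i
   lowers the sum of the p_i, so the Catalan words, p_(i+1) <= p_i + 1, span.
   A matrix entry of such a word is encoded by a binary string of length 2k, and
   removing the last factor D_(k-1)(p) amounts to deleting the letters p and p + 1 of
   the string, which have to differ.  Inserting 01 at the positions p_i one after the
   other gives a canonical string for each Catalan word, which starts with exactly
   p_(k-1) + 1 zeros, so that a word not vanishing there has its last p at least
   as large.
   The matrix of these entries is therefore triangular for the lexicographic order of
   the sequences (p_(k-1), ..., p_0), so the Catalan words are independent in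
   End(V^(x)k).

   A word is stored as the list [p_(k-1); ...; p_0]; false and true stand for v_1
   and v_2. *)

(** * Normal words *)

Fixpoint loose (P : seq nat) : bool :=
  if P is p :: ps then (p <= size ps)%N && loose ps else true.

Definition cat_bound (P : seq nat) : nat := if P is p :: _ then p.+1 else 0.

Fixpoint catalan (P : seq nat) : bool :=
  if P is p :: ps then (p <= cat_bound ps)%N && catalan ps else true.

Fixpoint catalans (k : nat) : seq (seq nat) :=
  if k is k'.+1 then
    [seq p :: ps | ps <- catalans k', p <- iota 0 (cat_bound ps).+1]
  else [:: [::]].

Arguments catalans : simpl never.

Lemma catalansS k :
  catalans k.+1 =
  [seq p :: ps | ps <- catalans k, p <- iota 0 (cat_bound ps).+1].
Proof. by []. Qed.

Lemma mem_catalans k P : (P \in catalans k) = catalan P && (size P == k).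
Proof.
elim: k P => [|k IHk] [|p ps] //; first by rewrite /= andbF.
  by rewrite catalansS; apply/negbTE/negP => /allpairsPdep [ps [p []]].
rewrite catalansS; apply/allpairsPdep/idP => [[qs [p' [qsL p'L [-> ->]]]]|].
  have /andP[cat_qs sz_qs] : catalan qs && (size qs == k) by rewrite -IHk.
  rewrite /= eqSS cat_qs sz_qs !andbT.
  have : p' \in iota 0 (cat_bound qs).+1 by [].
  by rewrite mem_iota ltnS.
rewrite /= eqSS -andbA => /andP[le_p cat_ps].
by exists ps, p; rewrite IHk (mem_iota 0 (cat_bound ps).+1) ltnS.
Qed.

Lemma catalans_uniq k : uniq (catalans k).
Proof.
elim: k => // k IHk; rewrite catalansS; apply: allpairs_uniq_dep => //.
  by move=> ps _; apply: (iota_uniq 0 (cat_bound ps).+1).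
by move=> [ps p] [ps' p'] _ _ /= [-> ->].
Qed.

Lemma catalan_loose P : catalan P -> loose P.
Proof.
elim: P => //= p ps IH /andP[le_p /IH ps_loose]; rewrite ps_loose andbT.
by case: ps le_p ps_loose {IH} => //= p' ps le_p /andP[] *; lia.
Qed.

Section Words.
Variables (K : fieldType) (m : nat).

(** Natural-number indices keep the index arithmetic free of ordinals. Out of range, the value 0
    still satisfies the commutation and square relations. *)
Definition ncgen (a : nat) : ncterm K m :=
  if insub a is Some i then NGen i else NScal 0.

(* t_(i-1) ... t_(p+1) t_p *)
Fixpoint desc (i p : nat) : ncterm K m :=
  if i is i'.+1 then
    if (p <= i')%N then NMul (ncgen i') (desc i' p) else NScal 1
  else NScal 1.

Fixpoint nword (P : seq nat) : ncterm K m :=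
  if P is p :: ps then NMul (nword ps) (desc (size ps) p) else NScal 1.

Definition lincomb (c : seq nat -> K) (L : seq (seq nat)) : ncterm K m :=
  foldr (fun w Q => NAdd (NMul (NScal (c w)) (nword w)) Q) (NScal 0) L.

(** * Temperley-Lieb identities between descending products *)

Section Eval.
Variables (A : algType K) (xi : K) (g : 'I_m -> A).
Hypothesis relg : TL_rel xi g.

Local Notation t a := (nceval g (ncgen a)).
Local Notation D i p := (nceval g (desc i p)).

Lemma ncgenE (a : nat) (lt_am : (a < m)%N) : t a = g (Ordinal lt_am).
Proof. by rewrite /ncgen insubT. Qed.

Lemma ncgen_out (a : nat) : (m <= a)%N -> t a = 0.
Proof. by move=> le_ma; rewrite /ncgen insubN -?leqNgt //= scale0r. Qed.

Lemma ncgen_comm a b : (a.+1 < b)%N -> t a * t b = t b * t a.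
Proof.
move=> lt_ab; case: (ltnP b m) => [lt_bm|/ncgen_out->]; last first.
  by rewrite mulr0 mul0r.
have lt_am : (a < m)%N by lia.
by rewrite !ncgenE; case: relg => comm _ _ _; apply: comm; rewrite /= lt_ab.
Qed.

Lemma ncgen_up a : (a.+1 < m)%N -> t a * t a.+1 * t a = t a.
Proof.
move=> lt_am; have lt_am' : (a < m)%N by lia.
by rewrite !ncgenE; case: relg => _ _ up _; apply: up.
Qed.

(** In the relation equating two differences, the left one vanishes by [ncgen_up], hence so does the
    right one. *)
Lemma ncgen_down a : (a.+1 < m)%N -> t a.+1 * t a * t a.+1 = t a.+1.
Proof.
move=> lt_am; have lt_am' : (a < m)%N by lia.
have := ncgen_up lt_am; rewrite !ncgenE; case: relg => _ braid _ _ up.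
have /= := braid (Ordinal lt_am') (Ordinal lt_am) erefl.
by rewrite up subrr => /esym/eqP; rewrite subr_eq0 => /eqP.
Qed.

Lemma ncgen_sq a : t a * t a = xi *: t a.
Proof.
case: (ltnP a m) => [lt_am|/ncgen_out->]; last by rewrite mulr0 scaler0.
by rewrite ncgenE; case: relg.
Qed.

Lemma desc_ge i p : (i <= p)%N -> D i p = 1.
Proof.
case: i => [|i] lt_ip /=; first exact: scale1r.
by rewrite (ltn_geF lt_ip) /= scale1r.
Qed.

Lemma descS i p : (p <= i)%N -> D i.+1 p = t i * D i p.
Proof. by move=> /= ->. Qed.

Lemma desc_cat i c p : (p <= c <= i)%N -> D i p = D i c * D c p.
Proof.
elim: i => [|i IHi] /andP[le_pc le_ci].
  by rewrite !(desc_ge (i := 0)) // desc_ge ?mulr1 //; lia.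
case: (eqVneq c i.+1) => [->|ne_ci]; first by rewrite (desc_ge (leqnn _)) mul1r.
by rewrite !descS ?IHi -?mulrA //; lia.
Qed.

Lemma desc1 i : D i.+1 i = t i.
Proof. by rewrite descS // desc_ge // mulr1. Qed.

Lemma desc_recr i p : (p < i)%N -> D i p = D i p.+1 * t p.
Proof. by move=> lt_pi; rewrite (desc_cat (c := p.+1)) ?desc1 //; lia. Qed.

Lemma ncgen_desc_comm a i p :
  (a.+1 < p)%N || (i < a)%N -> t a * D i p = D i p * t a.
Proof.
elim: i => [|i IHi] H; first by rewrite desc_ge // mulr1 mul1r.
case: (leqP p i) => [le_pi|lt_ip]; last by rewrite desc_ge // mulr1 mul1r.
have IH : t a * D i p = D i p * t a by apply: IHi; lia.
rewrite !descS // mulrA -[RHS]mulrA -IH mulrA; congr (_ * _).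
by case/orP: H => H; [rewrite ncgen_comm | rewrite -ncgen_comm] => //; lia.
Qed.

Lemma desc_comm i p j p' : (i < p')%N -> D i p * D j p' = D j p' * D i p.
Proof.
elim: i => [|i IHi] lt_ip; first by rewrite desc_ge // mulr1 mul1r.
case: (leqP p i) => [le_pi|lt_ip']; last by rewrite desc_ge // mulr1 mul1r.
rewrite descS // -mulrA IHi; last by lia.
by rewrite mulrA ncgen_desc_comm ?mulrA //; lia.
Qed.

(** Split the descents to p at c + 1 on the left and at c + 2 on the right. Distant generators
    commute, and the two sides then differ by t_c t_(c+1) t_c = t_c. *)
Lemma desc_straighten i p c : (p <= c)%N -> (c < i)%N -> (i < m)%N ->
  D i p * D i.+1 c.+2 = D i c * D i.+1 p.
Proof.
move=> le_pc lt_ci lt_im.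
rewrite (desc_cat (i := i) (c := c.+1) (p := p)); last by lia.
rewrite (desc_cat (i := i.+1) (c := c.+2) (p := p)); last by lia.
rewrite -mulrA desc_comm // (desc_recr lt_ci).
rewrite (descS (i := c.+1)) ?(descS (i := c)); try lia.
rewrite -[RHS]mulrA; congr (_ * _).
rewrite [RHS]mulrA (ncgen_desc_comm (a := c) (i := i.+1)); last by lia.
rewrite -[RHS]mulrA; congr (_ * _).
by rewrite !mulrA ncgen_up //; lia.
Qed.

Lemma desc_mul_next i p : (p.+1 < i)%N -> (i <= m)%N ->
  D i p * t p.+1 = D i p.+1.
Proof.
move=> lt_pi le_im; rewrite (desc_recr (p := p)); last by lia.
by rewrite desc_recr // -!mulrA (mulrA (t _)) ncgen_down //; lia.
Qed.

(** The generator passes the lower part D_b(p) and meets t_(b+1) t_b, where t_(b+1) t_b t_(b+1) =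
    t_(b+1) cuts the descent in two. *)
Lemma desc_mul_far i p b : (p < b)%N -> (b.+1 < i)%N -> (i <= m)%N ->
  D i p * t b.+1 = D b p * D i b.+1.
Proof.
move=> lt_pb lt_bi le_im; rewrite (desc_cat (i := i) (c := b.+2)); last by lia.
rewrite (descS (i := b.+1)) ?(descS (i := b)); try lia.
rewrite -!mulrA -(ncgen_desc_comm (a := b.+1)) ?ltnSn ?orbT //.
rewrite (mulrA (t b)) (mulrA (t b.+1)) (mulrA (t b.+1)) ncgen_down; last by lia.
by rewrite mulrA -desc_recr // -desc_comm.
Qed.

Lemma lincombE c L :
  nceval g (lincomb c L) = \sum_(w <- L) c w *: nceval g (nword w).
Proof.
elim: L => [|w L IHL] /=; first by rewrite big_nil scale0r.
by rewrite big_cons IHL mulr_algl.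
Qed.

End Eval.

(** * Catalan words span the algebra *)

Variable xi : K.
Local Notation "P =TL Q" := (TL_eq xi P Q) (at level 70).

Lemma straighten_step P : loose P -> (size P <= m.+1)%N -> ~~ catalan P ->
  exists P', [/\ loose P', size P' = size P, (sumn P' < sumn P)%N
               & nword P =TL nword P'].
Proof.
elim: P => //= p ps IH /andP[le_p ps_loose] le_sz.
case: (boolP (catalan ps)) => [cat_ps|ncat_ps]; last first.
  have [ps' [ps'_loose eq_sz lt_sum eq_ps]] := IH ps_loose (ltnW le_sz) ncat_ps.
  move=> _; exists (p :: ps'); rewrite /= eq_sz le_p; split=> //; first by lia.
  by move=> A g rel_g /=; rewrite (eq_ps A g rel_g).
rewrite andbT -ltnNge.
case: ps le_p ps_loose le_sz {cat_ps IH} => [|p' ps] /=; first by lia.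
move=> le_p /andP[le_p' ps_loose] le_sz lt_p'p.
(* A violation means p >= p' + 2, so [desc_straighten] applies with c = p - 2; the sum drops by
   2. *)
exists (p' :: p.-2 :: ps); rewrite /= ps_loose; split => //; try lia.
move=> A g rel_g /=; have -> : p = p.-2.+2 by lia.
by rewrite -mulrA (desc_straighten rel_g) ?mulrA //=; lia.
Qed.

Lemma straighten P : loose P -> (size P <= m.+1)%N ->
  exists P', [/\ catalan P', size P' = size P & nword P =TL nword P'].
Proof.
elim: {P}(sumn P) {-2}P (leqnn (sumn P)) => [|N IHN] P le_sum P_loose le_sz;
  (case: (boolP (catalan P)) => [cat_P|ncat]; first by exists P);
  have [P' [P'_loose eq_sz lt_sum eq_P]] := straighten_step P_loose le_sz ncat.
  by lia.
have [||Q [cat_Q eq_sz' eq_Q]] := IHN P' _ P'_loose; try lia.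
exists Q; rewrite eq_sz' eq_sz; split=> // A g rel_g.
by rewrite (eq_P A g rel_g) (eq_Q A g rel_g).
Qed.

Definition mul_closed_at (P : seq nat) (Q : ncterm K m) :=
  exists c P', [/\ loose P', size P' = size P
                 & NMul (nword P) Q =TL NMul (NScal c) (nword P')].

(** This extends the induction hypothesis of [loose_mul_gen] from one generator to a descent,
    because a generator meeting the last factor of a word can release a whole descent onto the
    shorter word. *)
Lemma loose_mul_desc N j p :
  (forall a P, loose P -> size P = N -> (a.+1 < N)%N ->
     mul_closed_at P (ncgen a)) ->
  (j < N)%N -> forall P, loose P -> size P = N -> mul_closed_at P (desc j p).
Proof.
move=> closed_gen; elim: j => [|j IHj] lt_jN P P_loose sz_P.
  exists 1, P; split=> // A g rel_g /=.
  by rewrite scale1r mulr1 mul1r.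
case: (leqP p j) => [le_pj|lt_jp]; last first.
  exists 1, P; split=> // A g rel_g.
  rewrite [LHS]/= -/(desc j.+1 p) -[X in _ * X]/(nceval g (desc j.+1 p)).
  by rewrite desc_ge //= scale1r mulr1 mul1r.
have [c [P' [P'_loose sz_P' eqP']]] := closed_gen j P P_loose sz_P lt_jN.
have [||c' [P'' [P''_loose sz_P'' eqP'']]] := IHj _ P' P'_loose; try lia.
exists (c * c'), P''; split; rewrite ?sz_P'' // => A g rel_g.
rewrite [LHS]/= -[X in _ * X]/(nceval g (desc j.+1 p)) descS // mulrA.
have /= -> := eqP' A g rel_g; have /= := eqP'' A g rel_g.
by rewrite !mulr_algl -scalerAl => ->; rewrite scalerA.
Qed.

(** Compare a with the end p of the last descent. If a + 1 < p, t_a passes it and acts on the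
    shorter word; if a + 1 = p, it prolongs the descent; if a = p, it yields the factor xi; if a = p
    + 1, it cancels t_p; beyond that, [desc_mul_far] applies. *)
Lemma loose_mul_gen P a : loose P -> (size P <= m.+1)%N -> (a.+1 < size P)%N ->
  mul_closed_at P (ncgen a).
Proof.
elim: {P}(size P) {-2}P (erefl (size P)) a => [|N IHN] [] //= p ps [sz_ps] a.
move=> /andP[le_p ps_loose] le_sz lt_a; rewrite -sz_ps in IHN le_sz lt_a.
have [lt_ap|lt_pa|eq_ap] := ltngtP a.+1 p.
- have [|c [P' [P'_loose sz_P' eqP']]] := IHN ps erefl a ps_loose (ltnW le_sz); first lia.
  exists c, (p :: P'); rewrite /= sz_P' le_p; split=> // A g rel_g /=.
  rewrite -mulrA -(ncgen_desc_comm rel_g) ?lt_ap // mulrA.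
  by have /= -> := eqP' A g rel_g; rewrite mulrA.
- have [lt_ap|lt_pa'|eq_ap] := ltngtP a p.+1.
  + have {lt_ap lt_pa} eq_ap : a = p by lia.
    rewrite {a}eq_ap in lt_a *.
    exists xi, (p :: ps); rewrite /= le_p ps_loose; split=> // A g rel_g /=.
    rewrite -mulrA desc_recr // -mulrA (ncgen_sq rel_g).
    by rewrite -!scalerAr mulr_algl.
  + case: a lt_a lt_pa lt_pa' => // b lt_a lt_pa lt_pa'.
    have [||c [P' [P'_loose sz_P' eqP']]] :=
      loose_mul_desc (N := size ps) (j := b) p _ _ ps_loose erefl; try lia.
      by move=> a' Q Q_loose sz_Q ?; apply: IHN; rewrite ?sz_Q // ltnW.
    exists c, (b.+1 :: P'); rewrite /= sz_P' P'_loose; split=> // [|A g rel_g /=].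
      by rewrite andbT; lia.
    rewrite -mulrA (desc_mul_far rel_g) ?mulrA //; try lia.
    by have /= -> := eqP' A g rel_g; rewrite -?mulrA.
  exists 1, (p.+1 :: ps); rewrite /= ps_loose; split=> // [|A g rel_g /=].
    by rewrite andbT; lia.
  rewrite eq_ap scale1r mul1r -mulrA (desc_mul_next rel_g) //; lia.
exists 1, (a :: ps); rewrite /= ps_loose; split=> // [|A g rel_g /=].
  by rewrite andbT; lia.
rewrite -eq_ap scale1r mul1r -mulrA -desc_recr //; lia.
Qed.

Definition spanned (Q : ncterm K m) :=
  exists c, Q =TL lincomb c (catalans m.+1).

Lemma spanned_eq Q Q' : Q =TL Q' -> spanned Q' -> spanned Q.
Proof. by move=> eqQ [c eqc]; exists c => A g rel_g; rewrite eqQ // eqc. Qed.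

Lemma spanned_add Q Q' : spanned Q -> spanned Q' -> spanned (NAdd Q Q').
Proof.
move=> [c eqc] [c' eqc']; exists (fun w => c w + c' w) => A g rel_g /=.
rewrite eqc // eqc' // !lincombE -big_split /=.
by apply: eq_bigr => w _; rewrite scalerDl.
Qed.

Lemma spanned_scal a Q : spanned Q -> spanned (NMul (NScal a) Q).
Proof.
move=> [c eqc]; exists (fun w => a * c w) => A g rel_g /=.
rewrite eqc // !lincombE mulr_algl scaler_sumr.
by apply: eq_bigr => w _; rewrite scalerA.
Qed.

Lemma spanned_word P : loose P -> size P = m.+1 -> spanned (nword P).
Proof.
move=> P_loose sz_P; have [|P' [cat_P' sz_P' eqP]] := straighten P_loose.
  by rewrite sz_P.
exists (fun w => (w == P')%:R) => A g rel_g; rewrite eqP // lincombE.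
rewrite (bigD1_seq P') ?catalans_uniq //=; last first.
  by rewrite mem_catalans cat_P' sz_P' sz_P eqxx.
by rewrite eqxx scale1r big1 ?addr0 // => w /negPf->; rewrite scale0r.
Qed.

(** Induction on Q with P arbitrary, so that a product acts factor by factor. A generator turns each
    Catalan word into a multiple of a loose one, which is straightened again. *)
Lemma spanned_mul Q P : spanned P -> spanned (NMul P Q).
Proof.
elim: Q P => [a|a|Q1 IH1 Q2 IH2|Q1 IH1 Q2 IH2] P.
- move=> [c eqc]; pose L := catalans m.+1.
  have sL w : w \in L -> loose w /\ size w = m.+1.
    by rewrite mem_catalans => /andP[/catalan_loose ? /eqP].
  apply: (@spanned_eq _ (NMul (lincomb c L) (NGen a))).
    by move=> A g rel_g /=; rewrite eqc.
  elim: L sL {eqc} => [|w L IHL] sL.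
    exists (fun=> 0) => A g rel_g /=; rewrite scale0r mul0r lincombE big1 //.
    by move=> w _; rewrite scale0r.
  apply: (@spanned_eq _ (NAdd (NMul (NScal (c w)) (NMul (nword w) (NGen a)))
                              (NMul (lincomb c L) (NGen a)))).
    by move=> A g rel_g /=; rewrite mulrDl !mulrA.
  apply: spanned_add; last by apply: IHL => w' w'L; apply: sL; rewrite inE w'L orbT.
  have [|w_loose sz_w] := sL w; first by rewrite inE eqxx.
  apply: spanned_scal.
  have [||c' [P' [P'_loose sz_P' eqP']]] := @loose_mul_gen w a w_loose.
  - by rewrite sz_w.
  - by rewrite sz_w ltnS.
  apply: (@spanned_eq _ (NMul (NScal c') (nword P'))).
    by move=> A g rel_g; rewrite -eqP' //= ncgenE; congr (_ * g _); apply: val_inj.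
  by apply/spanned_scal/spanned_word; rewrite ?sz_P'.
- move=> /(spanned_scal a); apply: spanned_eq => A g rel_g /=.
  by rewrite mulr_algl mulr_algr.
- move=> sP; apply: (@spanned_eq _ (NAdd (NMul P Q1) (NMul P Q2))).
    by move=> A g rel_g /=; rewrite mulrDr.
  by apply: spanned_add; [apply: IH1 | apply: IH2].
- move=> sP; apply: (@spanned_eq _ (NMul (NMul P Q1) Q2)).
    by move=> A g rel_g /=; rewrite mulrA.
  by apply/IH2/IH1.
Qed.

Lemma all_spanned Q : spanned Q.
Proof.
(* With p_i = i every descent is empty, so this word evaluates to 1 and can be put in front of Q. *)
pose P0 k := rev (iota 0 k).
have P0S k : P0 k.+1 = k :: P0 k by rewrite /P0 -addn1 iotaD rev_cat.
have P0_loose k : loose (P0 k).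
  by elim: k => // k IHk; rewrite P0S /= IHk size_rev size_iota leqnn.
have P0_word k (A : algType K) (g : 'I_m -> A) : nceval g (nword (P0 k)) = 1.
  elim: k => [|k IHk]; first by rewrite /= scale1r.
  by rewrite P0S /= IHk mul1r desc_ge // size_rev size_iota.
apply: (@spanned_eq _ (NMul (nword (P0 m.+1)) Q)).
  by move=> A g rel_g /=; rewrite P0_word mul1r.
by apply/spanned_mul/spanned_word; rewrite // size_rev size_iota.
Qed.

End Words.

(** * Triangularity *)

Definition del2 (p : nat) (s : seq bool) := take p s ++ drop p.+2 s.

(** For a loose P and s of twice its length, the deleted pairs form a noncrossing matching whose
    arcs must all join different letters. By [entry_word] this decides whether a matrix entry is
    nonzero. *)
Fixpoint hit (P : seq nat) (s : seq bool) : bool :=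
  if P is p :: ps then
    (nth false s p != nth false s p.+1) && hit ps (del2 p s)
  else true.

Fixpoint canon (P : seq nat) : seq bool :=
  if P is p :: ps then
    take p (canon ps) ++ [:: false, true & drop p (canon ps)]
  else [::].

Lemma size_canon P : size (canon P) = (size P).*2.
Proof.
elim: P => //= p ps IH; rewrite doubleS -IH -{3}(cat_take_drop p (canon ps)).
by rewrite !size_cat /= !addnS.
Qed.

(** The condition p <= p' + 1 puts the inserted 01 inside or right after the initial zeros of the
    shorter string, so exactly p zeros precede it. *)
Lemma canon_head p ps : catalan (p :: ps) ->
  exists s, canon (p :: ps) = nseq p.+1 false ++ true :: s.
Proof.
elim: ps p => [|p' ps IH] p; first by case: p => //= _; exists [::].
rewrite [catalan _]/= => /andP[le_p /IH[s eq_s]].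
rewrite [canon _]/= -/(canon (p' :: ps)) eq_s.
exists (drop p (nseq p'.+1 false ++ true :: s)).
have -> : take p (nseq p'.+1 false ++ true :: s) = nseq p false.
  rewrite takel_cat ?size_nseq // -{1}(subnKC le_p) nseqD take_cat size_nseq.
  by rewrite ltnn subnn take0 cats0.
by rewrite -[p.+1]addn1 nseqD -catA.
Qed.

Lemma size_take_canon p ps : (p <= (size ps).*2)%N -> size (take p (canon ps)) = p.
Proof. by move=> le_p; rewrite size_takel ?size_canon. Qed.

Lemma del2_canon p ps : (p <= (size ps).*2)%N ->
  del2 p (canon (p :: ps)) = canon ps.
Proof.
move=> /size_take_canon szt; rewrite /del2 /= take_cat szt ltnn subnn take0 cats0.
by rewrite drop_cat szt ltnNge leqW // -addn2 addKn /= drop0 cat_take_drop.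
Qed.

Lemma hit_canon P : loose P -> hit P (canon P).
Proof.
elim: P => //= p ps IH /andP[le_p /IH ps_hit].
have le_p2 : (p <= (size ps).*2)%N by rewrite -addnn; lia.
rewrite -/(canon (p :: ps)) del2_canon // ps_hit andbT /=.
rewrite !nth_cat size_take_canon // ltnn subnn ltnNge leqnSn subSnn //.
Qed.

Definition lex (P Q : seq nat) : bool :=
  ((P : seqlexi nat) <= (Q : seqlexi nat))%O.

(** A head of Q smaller than that of P would compare two of the initial zeros of [canon P]. If the
    heads agree, the deletion leaves the canonical string of the tail. *)
Lemma hit_lex P Q : catalan P -> size Q = size P -> hit Q (canon P) -> lex P Q.
Proof.
rewrite /lex.
elim: P Q => [|p ps IH] [|p' ps'] // cat_P [sz] /andP[ne_p hit_ps'].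
rewrite Order.SeqLexiOrder.Exports.lexi_cons !leEnat.
have [s eq_s] := canon_head cat_P.
have le_pp' : (p <= p')%N.
  rewrite leqNgt; apply: contraNN ne_p => lt_p'p.
  by rewrite eq_s !nth_cat !size_nseq !nth_nseq !ifT //; lia.
rewrite le_pp' /=; apply/implyP => le_p'p.
have eq_p : p' = p by apply/eqP; rewrite eqn_leq le_p'p le_pp'.
move: (cat_P) => /catalan_loose /= /andP[le_p _]; move: cat_P => /andP[_ cat_ps].
move: hit_ps'; rewrite eq_p del2_canon; last by rewrite -addnn; lia.
by move=> hit_ps'; apply: IH.
Qed.

Lemma lex_max (L : seq (seq nat)) : L != [::] ->
  exists2 P, P \in L & {in L, forall Q, lex Q P}.
Proof.
rewrite /lex; elim: L => // P [|P' L] IH _.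
  by exists P; rewrite ?mem_seq1 // => Q; rewrite mem_seq1 => /eqP->.
have [Q QL Qmax] := IH isT.
have [le_PQ|/ltW le_QP] := leP (P : seqlexi nat) Q.
  exists Q => [|Q']; first by rewrite in_cons QL orbT.
  by rewrite in_cons => /predU1P[->|/Qmax].
exists P => [|Q']; first exact: mem_head.
rewrite in_cons => /predU1P[->|/Qmax] //.
by move/le_trans; apply.
Qed.

(* Evaluating a vanishing combination at the canonical string of its
   lexicographically largest word leaves only that word. *)
Lemma catalan_free (K : fieldType) (c : seq nat -> K)
    (f : seq nat -> seq bool -> K) k :
  (forall P s, loose P -> size P = k -> size s = k.*2 ->
     (f P s != 0) = hit P s) ->
  (forall s, size s = k.*2 -> \sum_(P <- catalans k) c P * f P s = 0) ->
  {in catalans k, forall P, c P = 0}.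
Proof.
move=> fE sum0 P PL; apply/eqP; apply: contraT => cP.
have [|Q] := @lex_max [seq Q <- catalans k | c Q != 0].
  by rewrite -has_filter; apply/hasP; exists P.
rewrite mem_filter mem_catalans => /andP[cQ /andP[cat_Q /eqP sz_Q]] Qmax.
have szc : size (canon Q) = k.*2 by rewrite size_canon sz_Q.
have := sum0 _ szc.
rewrite (bigD1_seq Q) ?catalans_uniq ?mem_catalans ?cat_Q ?sz_Q ?eqxx //=.
(* Any other word R with a nonzero term satisfies Q <= R by [hit_lex] and R <= Q by maximality. *)
rewrite [X in _ + X]big1_seq ?addr0 => [/eqP|R /andP[neRQ RL]]; last first.
  apply/eqP; rewrite mulf_eq0; apply: contraTT RL => /norP[cR fR].
  apply/negP => RL; move: (RL); rewrite mem_catalans => /andP[cat_R /eqP sz_R].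
  move: fR; rewrite fE ?catalan_loose // => /(hit_lex cat_Q).
  rewrite sz_R sz_Q => /(_ erefl) le_QR.
  have le_RQ : lex R Q by apply: Qmax; rewrite mem_filter cR.
  by move/eqP: neRQ; apply; apply: (@le_anti _ (seqlexi nat)); apply/andP; split.
rewrite mulf_eq0 (negPf cQ) /= => fQ0.
by have := hit_canon (catalan_loose cat_Q); rewrite -fE ?fQ0 // catalan_loose.
Qed.

(** * Tensor powers *)

Lemma split_adjacent (s : seq bool) p : (p.+1 < size s)%N ->
  s = take p s ++ [:: nth false s p, nth false s p.+1 & drop p.+2 s].
Proof.
move=> lt_p; rewrite -{1}(cat_take_drop p s) (drop_nth false) 1?ltnW //.
by rewrite (drop_nth false).
Qed.

Section Tensor.
Variable K : fieldType.

Lemma tensmxDl m n p q (A B : 'M[K]_(m, n)) (C : 'M[K]_(p, q)) :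
  (A + B) *t C = A *t C + B *t C.
Proof. by apply/matrixP=> i j; rewrite !mxE mulrDl. Qed.

Lemma tensmxDr m n p q (A : 'M[K]_(m, n)) (B C : 'M[K]_(p, q)) :
  A *t (B + C) = A *t B + A *t C.
Proof. by apply/matrixP=> i j; rewrite !mxE mulrDr. Qed.

Lemma tensmxZl m n p q a (A : 'M[K]_(m, n)) (B : 'M[K]_(p, q)) :
  (a *: A) *t B = a *: (A *t B).
Proof. by apply/matrixP=> i j; rewrite !mxE mulrA. Qed.

Lemma tensmxZr m n p q a (A : 'M[K]_(m, n)) (B : 'M[K]_(p, q)) :
  A *t (a *: B) = a *: (A *t B).
Proof. by apply/matrixP=> i j; rewrite !mxE mulrCA. Qed.

Lemma tens1mx1 m n : (1%:M : 'M[K]_m) *t (1%:M : 'M[K]_n) = 1%:M.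
Proof.
apply/matrixP => i j; case: (mxtens_indexP i) => i1 i2.
case: (mxtens_indexP j) => j1 j2; rewrite tensmxE !mxE -natrM mulnb.
congr (_ %:R : K); congr nat_of_bool.
by rewrite (can_eq (@mxtens_indexK _ _)) xpair_eqE.
Qed.

Definition bvec (b : bool) : 'cV[K]_2 := \col_i ((i : nat) == b)%:R.

(** The product has 1 * 1 columns; naming it fixes its type as a column vector. *)
Definition vt N (v : 'cV[K]_N) (b : bool) : 'cV[K]_(N * 2) := v *t bvec b.

Lemma vtD N (v w : 'cV[K]_N) b : vt (v + w) b = vt v b + vt w b.
Proof. exact: (tensmxDl v w (bvec b)). Qed.

Lemma vtZ N a (v : 'cV[K]_N) b : vt (a *: v) b = a *: vt v b.
Proof. exact: (tensmxZl a v (bvec b)). Qed.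

Lemma vt0 N b : vt (0 : 'cV[K]_N) b = 0.
Proof. exact: (@tens0mx _ N 1 2 1 (bvec b)). Qed.

Lemma tens_vt N (A : 'M[K]_N) (B : 'M[K]_2) v b :
  (A *t B) *m vt v b = (A *m v) *t (B *m bvec b).
Proof. exact: (tensmx_mul A B v (bvec b)). Qed.

Lemma tens1_vt N (A : 'M[K]_N) v b :
  (A *t (1%:M : 'M_2)) *m vt v b = vt (A *m v) b.
Proof. by rewrite tens_vt mul1mx. Qed.

Lemma vt_dot N (v w : 'cV[K]_N) b c :
  ((vt v b)^T *m vt w c) 0 0 = (b == c)%:R * (v^T *m w) 0 0.
Proof.
have -> : (b == c)%:R = \sum_i bvec b i 0 * bvec c i 0.
  rewrite big_ord_recr big_ord1 /= !mxE -!natrM -natrD.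
  by case: b; case: c.
rewrite mulrC !mxE mulr_sum; apply: eq_bigr => i _.
rewrite !mxE !(ord1 (mxtens_unindex (0 : 'I_(1 * 1))).1).
by rewrite mulrACA.
Qed.

(* The basis vector of V^(x)k indexed by y; the head of y is the last factor. *)
Fixpoint evec (k : nat) (y : seq bool) : 'cV[K]_(tdim k) :=
  match k return 'cV[K]_(tdim k) with
  | 0 => 1%:M
  | k'.+1 => vt (evec k' (behead y)) (head false y)
  end.

Lemma evec_delta k (j : 'I_(tdim k)) :
  exists2 y, size y = k & evec k y = delta_mx j 0.
Proof.
elim: k j => [|k IHk] j.
  exists [::] => //=; apply/matrixP => i i'.
  by rewrite !mxE [i]ord1 [j]ord1 [i']ord1.
case: (mxtens_indexP j) => j1 j2; have [y sz_y eq_y] := IHk j1.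
exists ((j2 == 1) :: y); first by rewrite /= sz_y.
rewrite /= eq_y; apply/colP => i; case: (mxtens_indexP i) => i1 i2.
rewrite !mxE mxtens_indexK /= !eqxx !andbT.
rewrite (can_eq (@mxtens_indexK _ _)) xpair_eqE -mulnb natrM.
congr (_ * (nat_of_bool _)%:R).
by case: i2 => [[|[|//]]] ?; case: j2 => [[|[|//]]] ?.
Qed.

Lemma mx_evec k N (M M' : 'M[K]_(N, tdim k)) :
  (forall y, size y = k -> M *m evec k y = M' *m evec k y) -> M = M'.
Proof.
move=> eqM; apply/matrixP => i j; have [y sz_y eq_y] := evec_delta j.
by have /colP/(_ i) := eqM y sz_y; rewrite eq_y -!colE !mxE.
Qed.

Lemma evec_cons k y b : evec k.+1 (b :: y) = vt (evec k y) b.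
Proof. by []. Qed.

End Tensor.

(** * Operators of cup-cap type and their matrix entries *)

Section CupCap.
Variables (K : fieldType) (phi ups : bool -> K) (T : forall k, nat -> 'M[K]_(tdim k)).

(** The family e stands for basis vectors in which only two adjacent letters vary; [phi] holds the
    coefficients of the cap and [ups] those of the cup. *)
Definition cupcap N (e : bool -> bool -> 'cV[K]_N) (b c : bool) :=
  if b == c then 0 else phi b *: (ups false *: e false true + ups true *: e true false).

Hypothesis T_rec : forall k a, a != k ->
  T k.+2 a = T k.+1 a *t (1%:M : 'M_2).
Hypothesis T_last : forall k (v : 'cV_(tdim k)) b c,
  T k.+2 k *m vt (vt v b) c = cupcap (fun b' c' => vt (vt v b') c') b c.

(** Lists start at the last tensor factor: v describes the a factors to the left of the pair, and b
    stands to the left of c. *)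
Lemma T_evec k a u v b c : size (u ++ [:: c, b & v]) = k -> size v = a ->
  T k a *m evec K k (u ++ [:: c, b & v]) =
  cupcap (fun b' c' => evec K k (u ++ [:: c', b' & v])) b c.
Proof.
move=> sz sz_v; elim: u k sz => [|d u IHu] k.
  by move=> <-; rewrite -sz_v; apply: T_last.
case: k => // k [sz]; have : (a.+1 < k)%N by rewrite -sz size_cat /= sz_v; lia.
case: k sz => // k sz lt_ak.
rewrite T_rec; last by lia.
rewrite cat_cons evec_cons (tens1_vt (N := tdim k.+1)) IHu // /cupcap.
case: eqP => _; first exact: vt0.
by rewrite vtZ vtD !vtZ.
Qed.

Fixpoint mxdesc (k i p : nat) : 'M[K]_(tdim k) :=
  if i is i'.+1 then
    if (p <= i')%N then T k i' *m mxdesc k i' p else 1%:M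
  else 1%:M.

Fixpoint mxword (k : nat) (P : seq nat) : 'M[K]_(tdim k) :=
  if P is p :: ps then mxword k ps *m mxdesc k (size ps) p else 1%:M.

Lemma mxdesc_ge k i p : (i <= p)%N -> mxdesc k i p = 1%:M.
Proof. by case: i => // i lt_ip /=; rewrite (ltn_geF lt_ip). Qed.

Lemma mxdesc_recr k i p : (p < i)%N ->
  mxdesc k i p = mxdesc k i p.+1 *m T k p.
Proof.
elim: i => // i IHi; rewrite ltnS => le_pi /=; rewrite le_pi.
case: ltngtP le_pi => // [lt_pi|->] _; first by rewrite IHi // mulmxA.
by rewrite mxdesc_ge // mulmx1 mul1mx.
Qed.

(** For i < k the descent acts on the first i + 1 <= k factors only; i = 0 is listed separately to
    cover k = 0. *)
Lemma mxdesc_tens k i p : (i < k)%N || (i == 0)%N ->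
  mxdesc k.+1 i p = mxdesc k i p *t (1%:M : 'M_2).
Proof.
elim: i => [|i IHi] /=; first by rewrite tens1mx1.
rewrite orbF => lt_ik; case: ifP => _; last by rewrite tens1mx1.
rewrite IHi ?(ltnW lt_ik) //; case: k lt_ik {IHi} => // k lt_ik.
by rewrite T_rec ?tensmx_mul ?mulmx1 //; lia.
Qed.

Lemma mxword_tens k P : (size P <= k)%N ->
  mxword k.+1 P = mxword k P *t (1%:M : 'M_2).
Proof.
elim: P => [|p ps IHP] /= lt_k; first by rewrite tens1mx1.
by rewrite IHP ?(ltnW lt_k) // mxdesc_tens ?lt_k // tensmx_mul mulmx1.
Qed.

(* The string s is the reversed complement of the column index followed by the
   row index. *)
Definition entry k (F : 'M[K]_(tdim k)) (s : seq bool) : K :=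
  ((evec K k (drop k s))^T *m F *m evec K k (rev (map negb (take k s)))) 0 0.

(** The middle letters belong to the last strand, b being its complemented column letter.
    Complementing makes a through strand join different letters, just as an arc does. *)
Lemma entry_tens k (F : 'M[K]_(tdim k)) s1 b c s2 :
  size s1 = k -> size s2 = k ->
  entry (k := k.+1) (F *t (1%:M : 'M_2)) (s1 ++ [:: b, c & s2]) =
  (b != c)%:R * entry F (s1 ++ s2).
Proof.
move=> sz1 sz2; rewrite /entry -cat_rcons.
rewrite !take_size_cat ?drop_size_cat ?size_rcons ?sz1 //.
rewrite map_rcons rev_rcons -[LHS]/(((vt (evec K k s2) c)^T *m
   (F *t (1%:M : 'M_2)) *m vt (evec K k (rev (map negb s1))) (~~ b)) 0 0).
rewrite -mulmxA tens1_vt vt_dot mulmxA; congr (_%:R * _).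
by case: b; case: c.
Qed.

(** T acts on the column, whose letters are complemented in the string: the cup term with
    coefficient [ups false] appears there as true, false. *)
Lemma entry_mul k (F : 'M[K]_(tdim k)) s1 b c s2 : ((size s1).+1 < k)%N ->
  (k <= (size s1 + size s2).+2)%N ->
  entry (F *m T k (size s1)) (s1 ++ [:: b, c & s2]) =
  (b != c)%:R * (phi (~~ b) * (ups false * entry F (s1 ++ [:: true, false & s2]) +
                               ups true * entry F (s1 ++ [:: false, true & s2]))).
Proof.
move=> lt_s1k le_k; pose d := (k - (size s1).+2)%N.
have eq_d : (k - size s1)%N = d.+2 by rewrite /d; lia.
have takek b' c' : take k (s1 ++ [:: b', c' & s2]) = s1 ++ [:: b', c' & take d s2].
  by rewrite take_cat ltnNge ltnW ?(ltnW lt_s1k) //= eq_d.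
have dropk b' c' : drop k (s1 ++ [:: b', c' & s2]) = drop d s2.
  by rewrite drop_cat ltnNge ltnW ?(ltnW lt_s1k) //= eq_d.
rewrite /entry !takek !dropk !map_cat !rev_cat /= !rev_cons !cat_rcons.
rewrite mulmxA -(mulmxA _ (T k _)).
rewrite T_evec; first last.
- by rewrite size_rev size_map.
- by rewrite size_cat /= !size_rev !size_map size_takel /d; lia.
rewrite /cupcap eqb_negLR negbK eq_sym; case: eqP => _.
  by rewrite mulmx0 mul0r mxE.
by rewrite mul1r -scalemxAr mulmxDr -!scalemxAr !mxE.
Qed.

Hypothesis phi_neq0 : forall b, phi b != 0.
Hypothesis ups_neq0 : forall b, ups b != 0.

(** Induction on the number of generators in the descent. Of the two cup terms, only the one whose
    second letter differs from the next letter e can survive, and it leaves e behind; hence nothing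
    cancels. *)
Lemma entry_desc k (F : 'M[K]_(tdim k)) s1 b c s2 :
  (size s1 <= k)%N -> (size s1 + size s2)%N = k.*2 ->
  (entry (k := k.+1) ((F *t (1%:M : 'M_2)) *m mxdesc k.+1 k (size s1))
     (s1 ++ [:: b, c & s2]) != 0) = (b != c) && (entry F (s1 ++ s2) != 0).
Proof.
move: {-2}(k - size s1)%N (erefl (k - size s1)%N) => d.
elim: d s1 b c s2 => [|d IHd] s1 b c s2 eq_d le_k sz.
  have sz1 : size s1 = k by lia.
  rewrite mxdesc_ge ?sz1 // mulmx1 entry_tens //; last by lia.
  by case: (b == c); rewrite ?mul0r ?mul1r ?eqxx.
case: s2 sz => [|e s2] /= sz; first by lia.
rewrite mxdesc_recr ?mulmxA; last by lia.
rewrite entry_mul /=; try lia.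
have IH b' c' : (entry (k := k.+1) ((F *t (1%:M : 'M_2)) *m
       mxdesc k.+1 k (size s1).+1) (s1 ++ [:: b', c', e & s2]) != 0) =
     (c' != e) && (entry F (s1 ++ b' :: s2) != 0).
  by rewrite -cat_rcons -(size_rcons s1 b') IHd ?cat_rcons ?size_rcons //; lia.
case: (b == c) => /=; first by rewrite mul0r eqxx.
rewrite mul1r mulf_eq0 negb_or phi_neq0 /=.
have := IH true false; have := IH false true; case: e {IH sz} => /=.
  by move/eqP => -> <-; rewrite mulr0 addr0 mulf_eq0 negb_or ups_neq0.
by move=> <- /eqP ->; rewrite mulr0 add0r mulf_eq0 negb_or ups_neq0.
Qed.

Lemma entry_word k P s : loose P -> size P = k -> size s = k.*2 ->
  (entry (mxword k P) s != 0) = hit P s.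
Proof.
elim: P k s => [|p ps IHP] [|k] s //=.
  move=> _ _ /eqP/nilP ->; rewrite /entry /= !mulmx1 trmx1 mxE.
  by rewrite eqxx /= oner_eq0.
move=> /andP[le_p ps_loose] [sz_ps] sz_s.
rewrite (@split_adjacent s p); last by rewrite sz_s -addnn; lia.
set b := nth _ _ _; set c := nth _ _ p.+1; set s1 := take _ _; set s2 := drop _ _.
have sz1 : size s1 = p by rewrite size_takel // sz_s -addnn; lia.
have sz2 : (size s1 + size s2)%N = k.*2.
  by rewrite sz1 size_drop sz_s -!addnn; lia.
rewrite mxword_tens ?sz_ps // -sz1 entry_desc ?sz1 -?sz_ps // ?IHP -?sz_ps //.
- rewrite /del2 !nth_cat sz1 ltnn subnn ltnNge leqnSn subSnn /=.
  by rewrite take_size_cat // drop_cat sz1 ltnNge leqW // -addn2 addKn /= drop0.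
- by rewrite size_cat sz2 sz_ps.
by rewrite -sz1 sz2 sz_ps.
Qed.

(** * Temperley-Lieb relations for cup-cap operators *)

Variable xi : K.
Hypothesis cap_cup : ups false * phi false + ups true * phi true = xi.
Hypothesis zigzag : phi false * ups false * (phi true * ups true) = 1.

Lemma split_evec (y : seq bool) a : (a.+1 < size y)%N ->
  exists u b c v, y = u ++ [:: c, b & v] /\ size v = a.
Proof.
move=> lt_a; pose p := (size y - a.+2)%N.
exists (take p y), (nth false y p.+1), (nth false y p), (drop p.+2 y).
by split; [apply: split_adjacent; lia | rewrite size_drop; lia].
Qed.

Lemma T_sq k a : (a.+1 < k)%N -> T k a *m T k a = xi *: T k a.
Proof.
move=> lt_ak; apply: mx_evec => y sz_y.
have [|u [b [c [v [eq_y sz_v]]]]] := @split_evec y a; first by rewrite sz_y.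
have sz b' c' : size (u ++ [:: c', b' & v]) = k by rewrite -sz_y eq_y !size_cat.
rewrite -mulmxA -scalemxAl eq_y !(T_evec (a := a)) // /cupcap.
case: eqP => _; first by rewrite mulmx0 scaler0.
(* The second application meets the cup vector and produces the loop value. *)
rewrite -scalemxAr mulmxDr -!scalemxAr !(T_evec (a := a)) // /cupcap /=.
move: (evec _ _ _) (evec _ _ _) => e e'.
by apply/matrixP => i j; rewrite !mxE -cap_cup; ring.
Qed.

Lemma T_comm k a a' : (a.+1 < a')%N -> (a'.+1 < k)%N ->
  T k a *m T k a' = T k a' *m T k a.
Proof.
move=> lt_aa' lt_a'k; apply: mx_evec => y sz_y.
have [|u [b' [c' [v' [eq_y sz_v']]]]] := @split_evec y a'; first by rewrite sz_y.
have [|w [b [c [v [eq_v' sz_v]]]]] := @split_evec v' a; first by rewrite sz_v'.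
pose E b' c' b c := evec K k (u ++ [:: c', b' & w ++ [:: c, b & v]]).
have sz b1 c1 b2 c2 : size (u ++ [:: c1, b1 & w ++ [:: c2, b2 & v]]) = k.
  by rewrite -sz_y eq_y eq_v' !size_cat /= !size_cat.
have hi b1 c1 b2 c2 :
    T k a' *m E b1 c1 b2 c2 = cupcap (fun b3 c3 => E b3 c3 b2 c2) b1 c1.
  by apply: T_evec => //; rewrite -sz_v' eq_v' !size_cat.
have lo b1 c1 b2 c2 :
    T k a *m E b1 c1 b2 c2 = cupcap (fun b3 c3 => E b1 c1 b3 c3) b2 c2.
  have eqE b3 c3 : E b1 c1 b3 c3 =
      evec K k ((u ++ [:: c1, b1 & w]) ++ [:: c3, b3 & v]) by rewrite -catA.
  rewrite eqE T_evec // -?catA; [by rewrite /cupcap -!catA | exact: sz].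
rewrite -!mulmxA eq_y eq_v' -/(E b' c' b c) lo hi /cupcap.
have [eq1|ne1] := boolP (b' == c'); have [eq2|ne2] := boolP (b == c).
- by rewrite !mulmx0.
- rewrite mulmx0 -scalemxAr mulmxDr -!scalemxAr !hi /cupcap eq1.
  by rewrite !scaler0 addr0 scaler0.
- rewrite mulmx0 -scalemxAr mulmxDr -!scalemxAr !lo /cupcap eq2.
  by rewrite !scaler0 addr0 scaler0.
rewrite -!scalemxAr !mulmxDr -!scalemxAr !lo !hi /cupcap (negPf ne1) (negPf ne2).
move: (E false true false true) (E false true true false)
  (E true false false true) (E true false true false) => e1 e2 e3 e4.
by apply/matrixP => i j; rewrite !mxE; ring.
Qed.

Section Adjacent.
Variables (N : nat) (M M' : 'M[K]_N) (E : bool -> bool -> bool -> 'cV[K]_N).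
Hypothesis lo : forall b c d,
  M *m E b c d = cupcap (fun b' c' => E b' c' d) b c.
Hypothesis hi : forall b c d,
  M' *m E b c d = cupcap (fun c' d' => E b c' d') c d.

Let mulE (A : 'M[K]_N) a b c (e e' : 'cV_N) :
  A *m (a *: (b *: e + c *: e')) = (a * b) *: (A *m e) + (a * c) *: (A *m e').
Proof. by rewrite -scalemxAr mulmxDr -!scalemxAr scalerDr !scalerA. Qed.

(** With all but three adjacent letters frozen in E, this is a check of eight cases, in which the
    scalars agree up to the zigzag product. *)
Lemma adjacent_up b c d : M *m (M' *m (M *m E b c d)) = M *m E b c d.
Proof.
case: b; case: c; case: d; rewrite !(lo, hi, mulE, mulmxDr, mulmx0,
    scaler0, add0r, addr0, =^~ scalemxAr) /cupcap //= !scalerA;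
  by congr (_ *: _); rewrite -[RHS]mul1r -zigzag; ring.
Qed.

Lemma adjacent_down b c d : M' *m (M *m (M' *m E b c d)) = M' *m E b c d.
Proof.
case: b; case: c; case: d; rewrite !(lo, hi, mulE, mulmxDr, mulmx0,
    scaler0, add0r, addr0, =^~ scalemxAr) /cupcap //= !scalerA;
  by congr (_ *: _); rewrite -[RHS]mul1r -zigzag; ring.
Qed.

End Adjacent.

Lemma adjacent_basis k a y : (a.+2 < k)%N -> size y = k ->
  exists E b c d, [/\ evec K k y = E b c d,
    forall b c d, T k a *m E b c d = cupcap (fun b' c' => E b' c' d) b c &
    forall b c d, T k a.+1 *m E b c d = cupcap (fun c' d' => E b c' d') c d].
Proof.
move=> lt_ak sz_y.
have [|u [c [d [[|b v] [eq_y // [sz_v]]]]]] := @split_evec y a.+1.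
  by rewrite sz_y.
exists (fun b c d => evec K k (u ++ [:: d, c, b & v])), b, c, d.
have sz b' c' d' : size (u ++ [:: d', c', b' & v]) = k.
  by rewrite -sz_y eq_y !size_cat.
split=> [|b' c' d'|b' c' d']; first by rewrite eq_y.
  by rewrite -cat_rcons T_evec ?cat_rcons // /cupcap !cat_rcons.
by rewrite T_evec //= sz_v.
Qed.

Lemma T_up k a : (a.+2 < k)%N -> T k a *m T k a.+1 *m T k a = T k a.
Proof.
move=> lt_ak; apply: mx_evec => y sz_y; rewrite -!mulmxA.
have [E [b [c [d [-> lo hi]]]]] := adjacent_basis lt_ak sz_y.
exact: adjacent_up.
Qed.

Lemma T_down k a : (a.+2 < k)%N -> T k a.+1 *m T k a *m T k a.+1 = T k a.+1.
Proof.
move=> lt_ak; apply: mx_evec => y sz_y; rewrite -!mulmxA.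
have [E [b [c [d [-> lo hi]]]]] := adjacent_basis lt_ak sz_y.
exact: adjacent_down.
Qed.

End CupCap.

(** * Tensor products up to associativity *)

Section Cast.
Variable K : fieldType.

Lemma castmx_mulmx m m' p (e : m = m') (A : 'M[K]_m) (B : 'M[K]_(m, p)) :
  castmx (e, e) A *m castmx (e, erefl) B = castmx (e, erefl) (A *m B).
Proof. by case: m' / e. Qed.

Lemma castmx_vt N (v : 'cV[K]_N) b c :
  castmx (mulnA N 2 2, erefl 1%N) (v *t vt (bvec K b) c) = vt (vt v b) c.
Proof.
apply/colP => i; case: (mxtens_indexP i) => i12 i3.
case: (mxtens_indexP i12) => i1 i2; rewrite castmxE /=.
have -> : cast_ord (esym (mulnA N 2 2))
    (mxtens_index (mxtens_index (i1, i2), i3)) =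
  mxtens_index (i1, mxtens_index (i2, i3)) by apply: val_inj => /=; lia.
rewrite !mxE !mxtens_indexK /= mulrA.
congr (v _ _ * _ * _); apply: val_inj => //.
Qed.

Lemma castmxD m m' p (e : m = m') (A B : 'M[K]_(m, p)) :
  castmx (e, erefl) (A + B) = castmx (e, erefl) A + castmx (e, erefl) B.
Proof. by case: m' / e. Qed.

Lemma castmxZ m m' p (e : m = m') a (A : 'M[K]_(m, p)) :
  castmx (e, erefl) (a *: A) = a *: castmx (e, erefl) A.
Proof. by case: m' / e. Qed.

Lemma castmx_tens1_vt N (S : 'M[K]_(2 * 2)) (v : 'cV_N) b c x b1 c1 y b2 c2 :
  S *m vt (bvec K b) c = x *: vt (bvec K b1) c1 + y *: vt (bvec K b2) c2 ->
  castmx (mulnA N 2 2, mulnA N 2 2) ((1%:M : 'M_N) *t S) *m vt (vt v b) c =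
  x *: vt (vt v b1) c1 + y *: vt (vt v b2) c2.
Proof.
move=> eqS; rewrite -!castmx_vt castmx_mulmx -!castmxZ -castmxD.
congr (castmx _ _).
have -> : (1%:M *t S) *m (v *t vt (bvec K b) c) =
          (1%:M *m v) *t (S *m vt (bvec K b) c) by exact: tensmx_mul.
by rewrite eqS mul1mx tensmxDr !tensmxZr.
Qed.

Lemma castmx_affine m m' (e : m = m') (a b : K) (A : 'M_m) :
  castmx (e, e) (a *: (b *: A - 1%:M)) = a *: (b *: castmx (e, e) A - 1%:M).
Proof. by case: m' / e. Qed.

End Cast.

(** * The R-matrix *)

Arguments Vmat : simpl never.

Section DnModule.
Variables (K : fieldType) (q : K) (r : nat).
Hypothesis q_neq0 : q != 0.
Hypothesis q_neq1 : q != 1.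

(** Each generator maps a basis vector to a multiple of one. The target of a or d is constant since
    the other basis vector is killed. *)
Definition vcoef (x : Dgen) (b : bool) : K :=
  match x with
  | Ga => (~~ b)%:R
  | Gb => q ^+ (r + b)
  | Gc => q ^- (r + ~~ b)
  | Gd => b%:R * (1 - q^-1)
  end.

Definition vtarget (x : Dgen) (b : bool) : bool :=
  match x with Ga => true | Gd => false | _ => b end.

Lemma Vmat_bvec x b :
  Vmat q 2 r x *m bvec K b = vcoef x b *: bvec K (vtarget x b).
Proof.
have alpha12 : alpha q 1 2 = 1 - q^-1.
  by rewrite /alpha expr1 mulrC mulKf ?subr_eq0 // exprN1.
have expc (j : nat) : (j <= 1)%N ->
    q ^ ((j.+1)%:Z - (r + 2)%:Z) = q ^- (r + (1 - j)).
  by move=> le_j1; rewrite exprnN; congr (q ^ _); lia.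
apply/colP => i; rewrite /Vmat; case: x; rewrite !mxE big_ord_recr big_ord1 /= !mxE /=
  ?expc //; case: i => [[|[|//]]] ?;
  case: b => /=; rewrite ?alpha12 ?(mulr0, mul0r, mulr1, mul1r, addr0, add0r) //.
Qed.

Lemma tens_Vmat N (A : 'M[K]_N) x v b :
  (A *t Vmat q 2 r x) *m vt v b = vcoef x b *: vt (A *m v) (vtarget x b).
Proof. by apply/colP => i; rewrite tens_vt Vmat_bvec !mxE mulrCA. Qed.

Lemma Vmat_bvec_exp x m b : vtarget x b = b ->
  (Vmat q 2 r x ^+ m) *m bvec K b = vcoef x b ^+ m *: bvec K b.
Proof.
move=> tgt; elim: m => [|m IHm]; first by rewrite !expr0 mul1mx scale1r.
rewrite exprS -mulmxA IHm -scalemxAr Vmat_bvec tgt scalerA.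
by rewrite exprSr.
Qed.

Lemma rhoT_vt k x (v : 'cV[K]_(tdim k)) b :
  rhoT q r k.+1 x *m vt v b =
  match x with
  | Ga => vcoef Gb b *: vt (rhoT q r k Ga *m v) b + vcoef Ga b *: vt v true
  | Gd => vcoef Gc b *: vt (rhoT q r k Gd *m v) b + vcoef Gd b *: vt v false
  | _ => vcoef x b *: vt (rhoT q r k x *m v) b
  end.
Proof.
by case: x; rewrite [rhoT _ _ _ _]/= ?mulmxDl !(tens_Vmat (N := tdim k)) ?mul1mx.
Qed.

End DnModule.

Lemma prim_root_neq0 (R : fieldType) n (z : R) :
  n.-primitive_root z -> (2 <= n)%N -> z != 0.
Proof.
move=> prim_z n_ge2; apply/eqP => z0; have := prim_expr_order prim_z.
by rewrite z0 expr0n; case: n n_ge2 {prim_z} => // m _ /eqP; rewrite eq_sym oner_eq0.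
Qed.

Lemma prim_root_neq1 (R : fieldType) n (z : R) :
  n.-primitive_root z -> (2 <= n)%N -> z != 1.
Proof.
move=> prim_z n_ge2; apply/eqP => z1; have := eq_prim_root_expr prim_z 0 1.
by rewrite z1 !expr1n eqxx mod0n modn_small.
Qed.

Section RMatrix.
Variables (K : fieldType) (n : nat) (q : K) (r : nat).
Hypothesis prim_q : n.-primitive_root q.
Hypothesis n_neq0 : n%:R != 0 :> K.
Hypothesis n_ge2 : (2 <= n)%N.

Let q_neq0 : q != 0 := prim_root_neq0 prim_q n_ge2.
Let q_neq1 : q != 1 := prim_root_neq1 prim_q n_ge2.

(** Orthogonality of characters: z is an n-th root of unity, and z - 1 times the sum is z^n - 1 =
    0. *)
Lemma sum_root_of_unity e m : (m < n)%N ->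
  \sum_(t < n) (q ^+ e * q ^- m) ^+ t = n%:R * (m == e %% n)%N%:R.
Proof.
move=> lt_mn; set z := q ^+ e * q ^- m.
have zn : z ^+ n = 1.
  rewrite exprMn exprVn -!exprM ![(_ * n)%N]mulnC !exprM.
  by rewrite (prim_expr_order prim_q) !expr1n mul1r invr1.
have -> : (m == e %% n)%N = (z == 1).
  rewrite -(inj_eq (mulIf (expf_neq0 m q_neq0))) /z mulfVK ?expf_neq0 // mul1r.
  by rewrite (eq_prim_root_expr prim_q) (modn_small lt_mn) eq_sym.
case: eqVneq => [->|z_neq1].
  by rewrite (eq_bigr (fun=> 1)) ?sumr_const ?card_ord ?mulr1 // => t _; rewrite expr1n.
rewrite mulr0; apply: (mulfI (x := z - 1)); first by rewrite subr_eq0.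
by rewrite -subrX1 zn subrr mulr0.
Qed.

(** Summing over t selects the m congruent to e, and y^n = 1 undoes the reduction modulo n. Here q^e
    and y play the eigenvalues of b and c. *)
Lemma gauss_sum e (y : K) : y ^+ n = 1 ->
  n%:R^-1 * (\sum_(m < n) \sum_(t < n) q ^ (- (t * m)%:Z) * ((q ^+ e) ^+ t * y ^+ m))
  = y ^+ e.
Proof.
move=> yn.
have lt_en : (e %% n < n)%N by rewrite ltn_mod ltnW.
rewrite (eq_bigr (fun m : 'I_n => n%:R * ((m == Ordinal lt_en)%:R * y ^+ m))).
  rewrite -mulr_sumr mulKf // (bigD1 (Ordinal lt_en)) //= eqxx mul1r expr_mod //.
  by rewrite big1 ?addr0 // => m /negPf->; rewrite mul0r.
move=> m _; rewrite mulrA -[m == _]/(nat_of_ord m == e %% n)%N.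
rewrite -(sum_root_of_unity e (ltn_ord m)).
rewrite mulr_suml; apply: eq_bigr => t _.
by rewrite exprMn exprVn -(exprM q m t) (mulnC m t) exprnN mulrA [X in X * _]mulrC.
Qed.

(** As a and d square to zero on V, only s = 0 and s = 1 contribute. For fixed s, b and c act by
    eigenvalues and [gauss_sum] evaluates the double sum. *)
Lemma Rmat_bvec b c :
  Rmat q n r *m vt (bvec K b) c =
  vcoef q r Gc c ^+ (r + b) *: vt (bvec K b) c +
  (~~ b && c)%:R * (1 - q^-1) * vcoef q r Gc false ^+ r *: vt (bvec K true) false.
Proof.
have VE := Vmat_bvec r q_neq0 q_neq1.
have VX := @Vmat_bvec_exp _ _ r q_neq0 q_neq1.
have Yn c' : vcoef q r Gc c' ^+ n = 1.
  by rewrite /= exprVn -exprM mulnC exprM (prim_expr_order prim_q) expr1n invr1.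
have nilE x s b' : x = Ga \/ x = Gd -> Vmat q 2 r x ^+ s.+2 *m bvec K b' = 0.
  move=> xE; rewrite 2!exprSr -!mulmxA VE -scalemxAr VE.
  by case: xE => -> /=; rewrite !(scale0r, mul0r, mulmx0, scaler0).
have termE (s : nat) x b' y c' : Vmat q 2 r Ga ^+ s *m bvec K b = x *: bvec K b' ->
    Vmat q 2 r Gd ^+ s *m bvec K c = y *: bvec K c' ->
    n%:R^-1 *: (\sum_(m < n) \sum_(t < n)
      ((q ^ (- (t * m)%:Z)) / qfact q s) *:
       ((Vmat q 2 r Ga ^+ s *m Vmat q 2 r Gb ^+ t) *t
        (Vmat q 2 r Gc ^+ m *m Vmat q 2 r Gd ^+ s)) *m vt (bvec K b) c) =
    (x * y / qfact q s * vcoef q r Gc c' ^+ (r + b)) *: vt (bvec K b') c'.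
  move=> eqx eqy; rewrite -(gauss_sum (r + b) (Yn c')) mulrCA -scalerA.
  congr (_ *: _); rewrite mulr_sumr scaler_suml; apply: eq_bigr => m _.
  rewrite mulr_sumr scaler_suml; apply: eq_bigr => t _.
  rewrite -scalemxAl tens_vt -!mulmxA (VX Gb) // eqy -!scalemxAr eqx (VX Gc) //.
  move: (vcoef q r Gc c' ^+ m) => Y; rewrite [vcoef q r Gb b]/=.
  by apply/colP => i; rewrite !mxE; ring.
rewrite /Rmat -scalemxAl mulmx_suml.
under eq_bigr => m _.
  rewrite mulmx_suml; under eq_bigr => s _ do rewrite mulmx_suml.
  over.
rewrite exchange_big /= scaler_sumr.
have lt_0n : (0 < n)%N by rewrite ltnW.
rewrite (bigD1 (Ordinal lt_0n)) // [X in _ + X = _](bigD1 (Ordinal n_ge2)) //.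
rewrite [X in _ + (_ + X) = _]big1 ?addr0.
  rewrite (termE 0%N 1 b 1 c) ?expr0 ?mul1mx ?scale1r //.
  rewrite (termE 1%N (~~ b)%:R true (c%:R * (1 - q^-1)) false) ?expr1 ?VE //.
  rewrite /qfact big_ord0 big_ord1 /qint big_ord1 expr0 !divr1 !mul1r mulrA.
  case: b {termE} => /=; first by rewrite !mul0r !scale0r.
  by rewrite addn0 -natrM mul1n.
move=> [[|[|s]] //= lt_sn] _.
by rewrite (termE s.+2 0 b 0 c) ?scale0r ?nilE ?mul0r ?scale0r; auto.
Qed.

End RMatrix.

Lemma flipmx_vt (K : fieldType) b c :
  flipmx K *m vt (bvec K b) c = vt (bvec K c) b.
Proof.
apply/colP => i; case: (mxtens_indexP i) => i1 i2; rewrite mxE.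
rewrite (bigD1 (mxtens_index (i2, i1))) //= big1 ?addr0.
  by rewrite !mxE !mxtens_indexK /= !eqxx mul1r mulrC.
move=> j; case: (mxtens_indexP j) => j1 j2.
rewrite (can_eq (@mxtens_indexK _ _)) xpair_eqE => ne_j.
rewrite !mxE !mxtens_indexK /= (eq_sym i1) (eq_sym i2) andbC (negPf ne_j).
exact: mul0r.
Qed.

(** * The Temperley-Lieb generators obtained from the R-matrix *)

Section TLmatrices.
Variables (K : fieldType) (n : nat) (q sq : K) (r : nat).
Hypothesis prim_q : n.-primitive_root q.
Hypothesis n_neq0 : n%:R != 0 :> K.
Hypothesis n_ge2 : (2 <= n)%N.
Hypothesis sqE : sq ^+ 2 = q.

Let q_neq0 : q != 0 := prim_root_neq0 prim_q n_ge2.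
Let q_neq1 : q != 1 := prim_root_neq1 prim_q n_ge2.

Let sq_neq0 : sq != 0.
Proof. by move: q_neq0; rewrite -sqE; apply: contraNneq => ->; rewrite expr0n. Qed.

(** The rank-one factorisation is fixed up to scale by giving v_2 (x) v_1 coefficient 1 in the
    cup. *)
Definition cap_coef (b : bool) : K := if b then - sq else sq * q ^+ r.
Definition cup_coef (b : bool) : K := if b then 1 else - q ^- r.+1.

Lemma cap_coef_neq0 b : cap_coef b != 0.
Proof. by case: b; rewrite /= ?oppr_eq0 ?mulf_neq0 ?expf_neq0. Qed.

Lemma cup_coef_neq0 b : cup_coef b != 0.
Proof. by case: b; rewrite /= ?oppr_eq0 ?oner_eq0 ?invr_eq0 ?expf_neq0. Qed.

Lemma loop_value :
  cup_coef false * cap_coef false + cup_coef true * cap_coef true = - (sq + sq^-1).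
Proof.
have := expf_neq0 r q_neq0; rewrite /= exprSr; move: (q ^+ r) => w w_neq0.
by rewrite -sqE; field; rewrite w_neq0 sq_neq0.
Qed.

Lemma zigzag_value :
  cap_coef false * cup_coef false * (cap_coef true * cup_coef true) = 1.
Proof.
have := expf_neq0 r q_neq0; rewrite /= exprSr; move: (q ^+ r) => w w_neq0.
by rewrite -sqE; field; rewrite w_neq0 sq_neq0.
Qed.

Lemma Rcheck_vt b c :
  sq *: ((q ^ (- (r * r.+1)%:Z))^-1 *: Rcheck q n r - 1%:M) *m vt (bvec K b) c =
  (if b == c then 0 else cap_coef b * cup_coef false) *: vt (bvec K false) true +
  (if b == c then 0 else cap_coef b * cup_coef true) *: vt (bvec K true) false.
Proof.
rewrite -scalemxAl mulmxBl mul1mx -scalemxAl /Rcheck -mulmxA.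
rewrite (Rmat_bvec r prim_q n_neq0 n_ge2) mulmxDr -!scalemxAr !flipmx_vt.
have -> : (q ^ (- (r * r.+1)%:Z))^-1 = q ^+ (r * r.+1) by rewrite invr_expz opprK.
have L_neq0 : q ^+ (r * r.+1) != 0 by rewrite expf_neq0.
have w_neq0 : q ^+ r != 0 by rewrite expf_neq0.
(* Powers are brought over the denominator q^(r(r+1)), which leaves a rational identity in
   q^(r(r+1)), q^r and sq. *)
have expE i j m : (i * j + m = r * r.+1)%N ->
    q ^- i ^+ j = q ^+ m / q ^+ (r * r.+1).
  move=> <-; rewrite exprVn -exprM exprD invfM mulrCA mulfV ?mulr1 //.
  exact: expf_neq0.
have e00 : q ^- r.+1 ^+ r = (q ^+ (r * r.+1))^-1.
  by rewrite (expE _ _ 0%N) ?mul1r //; lia.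
have e11 : q ^- r ^+ r.+1 = (q ^+ (r * r.+1))^-1.
  by rewrite (expE _ _ 0%N) ?mul1r //; lia.
have e01 : q ^- r ^+ r = q ^+ r / q ^+ (r * r.+1) by apply: expE; lia.
have e10 : q ^- r.+1 ^+ r.+1 = q ^- r.+1 / q ^+ (r * r.+1).
  by rewrite [LHS]exprSr e00 mulrC.
case: b; case: c; rewrite /= ?addn1 ?addn0 ?e00 ?e01 ?e10 ?e11 ?exprSr;
  move: (q ^+ (r * r.+1)) (q ^+ r) L_neq0 w_neq0 {expE e00 e01 e10 e11};
  move=> L w L_neq0 w_neq0; apply/colP => i;
  move: (vt (bvec K _) _) (vt (bvec K _) _) => e e'; rewrite !mxE -sqE;
  by field; rewrite ?L_neq0 ?w_neq0 ?sq_neq0.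
Qed.

Lemma rhoTS k x : rhoT q r k.+1 x =
  match x with
  | Ga => rhoT q r k Ga *t Vmat q 2 r Gb + (1%:M : 'M_(tdim k)) *t Vmat q 2 r Ga
  | Gd => rhoT q r k Gd *t Vmat q 2 r Gc + (1%:M : 'M_(tdim k)) *t Vmat q 2 r Gd
  | _ => rhoT q r k x *t Vmat q 2 r x
  end.
Proof. by case: x. Qed.

Let T k a : 'M[K]_(tdim k) :=
  sq *: ((q ^ (- (r * r.+1)%:Z))^-1 *: RcheckI q n r k a.+1 - 1%:M).

Lemma TL_mx_rec k a : a != k -> T k.+2 a = T k.+1 a *t (1%:M : 'M_2).
Proof.
move=> ne_ak; rewrite /T tensmxZl; congr (_ *: _).
rewrite [RcheckI _ _ _ k.+2 _]/= eqSS (negPf ne_ak).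
by apply/matrixP => i j; rewrite -tens1mx1 !mxE mulrBl mulrA.
Qed.

Lemma TL_mx_last k (v : 'cV_(tdim k)) b c :
  T k.+2 k *m vt (vt v b) c = cupcap cap_coef cup_coef (fun b' c' => vt (vt v b') c') b c.
Proof.
have -> : T k.+2 k = castmx (mulnA (tdim k) 2 2, mulnA (tdim k) 2 2)
   ((1%:M : 'M_(tdim k)) *t
    (sq *: ((q ^ (- (r * r.+1)%:Z))^-1 *: Rcheck q n r - 1%:M))).
  have tensE : (1%:M : 'M_(tdim k)) *t
      (sq *: ((q ^ (- (r * r.+1)%:Z))^-1 *: Rcheck q n r - 1%:M)) =
      sq *: ((q ^ (- (r * r.+1)%:Z))^-1 *: ((1%:M : 'M_(tdim k)) *t Rcheck q n r)
             - 1%:M).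
    by rewrite tensmxZr tensmxDr tensmxZr -scaleN1r tensmxZr tens1mx1 scaleN1r.
  by rewrite tensE castmx_affine /T [RcheckI _ _ _ k.+2 _]/= eqxx.
rewrite (castmx_tens1_vt (N := tdim k) v (Rcheck_vt b c)) /cupcap.
by case: eqP => _; rewrite ?scale0r ?addr0 // scalerDr !scalerA.
Qed.

(** Off the last pair, T is a smaller T tensored with the identity, and it commutes with each
    summand of the coproduct by induction. The last pair is checked on basis vectors. *)
Lemma TL_mx_rhoT k a x : (a.+1 < k)%N ->
  T k a *m rhoT q r k x = rhoT q r k x *m T k a.
Proof.
elim: k x => // k IHk x lt_ak; case: k IHk lt_ak => // k IHk lt_ak.
have [->|ne_ak] := eqVneq a k; last first.
  have {}IHk y : T k.+1 a *m rhoT q r k.+1 y = rhoT q r k.+1 y *m T k.+1 a.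
    by apply: IHk; lia.
  rewrite TL_mx_rec // (rhoTS k.+1); case: x;
  by rewrite ?mulmxDl ?mulmxDr !tensmx_mul !mul1mx !mulmx1 ?IHk.
apply: mx_evec => [[|c [|b y]] // _].
rewrite -!mulmxA 2!evec_cons; move: (evec K k y) => v.
(* Hiding the tensor products behind W and R reduces the case analysis to scalar identities. *)
have [W [R [WE RE TW rhoW]]] :
    exists (W : 'cV_(tdim k) -> bool -> bool -> 'cV_(tdim k.+2)) R,
  [/\ forall w b c, vt (vt w b) c = W w b c,
      forall y, rhoT q r k.+2 y = R y,
      forall w b c, T k.+2 k *m W w b c = cupcap cap_coef cup_coef (W w) b c &
      forall w y b c, R y *m W w b c =
        let rw b' c' := W (rhoT q r k y *m w) b' c' in
        match y with
        | Ga => vcoef q r Gb c *: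
            (vcoef q r Gb b *: rw b c + vcoef q r Ga b *: W w true c) +
            vcoef q r Ga c *: W w b true
        | Gd => vcoef q r Gc c *:
            (vcoef q r Gc b *: rw b c + vcoef q r Gd b *: W w false c) +
            vcoef q r Gd c *: W w b false
        | _ => vcoef q r y c *: (vcoef q r y b *: rw b c)
        end].
  exists (fun w b c => vt (vt w b) c), (rhoT q r k.+2); split=> // [w b' c'|w g b' c'].
    exact: TL_mx_last.
  have rhoTE := rhoT_vt r q_neq0 q_neq1.
  have vtE := (@vtD K (tdim k.+1), @vtZ K (tdim k.+1)).
  by rewrite rhoTE; case: g; rewrite rhoTE !vtE.
have w_neq0 : q ^+ r != 0 by rewrite expf_neq0.
rewrite !WE RE TW rhoW; case: x; case: b; case: c;
  rewrite /cupcap /= ?(mulmxDr, mulmx0, TW, rhoW, =^~ scalemxAr) /cupcap /=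
    ?addn0 ?addn1 ?exprSr; apply/colP => i; rewrite !mxE;
  by field; rewrite ?q_neq0 ?w_neq0.
Qed.

End TLmatrices.

(** * Injectivity *)

Section MatrixEval.
Variables (K : fieldType) (m N : nat) (g : 'I_m -> 'M[K]_N).

Fixpoint mxeval (P : ncterm K m) : 'M[K]_N :=
  match P with
  | NGen i => g i
  | NScal c => c%:M
  | NAdd P1 P2 => mxeval P1 + mxeval P2
  | NMul P1 P2 => mxeval P1 *m mxeval P2
  end.

Lemma mxeval_lincomb c L :
  mxeval (lincomb m c L) = \sum_(w <- L) c w *: mxeval (nword K m w).
Proof.
elim: L => [|w L IHL] /=.
  by rewrite big_nil; apply/matrixP => i j; rewrite !mxE mul0rn.
by rewrite big_cons IHL mul_scalar_mx.
Qed.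

End MatrixEval.

(* Square matrices form an algebra only in positive size. *)
Lemma mxeval_TL_eq (K : fieldType) m N xi (g : 'I_m -> 'M[K]_N) P Q :
  (forall i j : 'I_m, (i.+1 < j)%N -> g i *m g j = g j *m g i) ->
  (forall i j : 'I_m, j = i.+1 :> nat -> g i *m g j *m g i = g i) ->
  (forall i j : 'I_m, j = i.+1 :> nat -> g j *m g i *m g j = g j) ->
  (forall i, g i *m g i = xi *: g i) ->
  TL_eq xi P Q -> mxeval g P = mxeval g Q.
Proof.
case: N g => [|N] g comm up down sqr eqPQ; first by apply/matrixP => -[].
have evalE R : mxeval g R = nceval (A := 'M[K]_N.+1) g R.
  elim: R => //= [c|R1 -> R2 ->|R1 -> R2 ->] //.
  by rewrite scalemx1.
rewrite !evalE; apply: eqPQ; split=> // i j.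
- by case/orP => ?; [apply: comm | symmetry; apply: comm].
- by move=> eq_j; rewrite [X in X - _]up ?[X in _ = X - _]down // !subrr.
Qed.

Section Word.
Variables (K : fieldType) (m : nat) (T : forall k, nat -> 'M[K]_(tdim k)).

Local Notation ev := (mxeval (fun j : 'I_m => T m.+1 j)).

Lemma mxeval_desc i p : (i <= m)%N -> ev (desc K m i p) = mxdesc T m.+1 i p.
Proof.
elim: i => //= i IHi lt_im; case: ifP => // _ /=.
by rewrite IHi ?(ltnW lt_im) // /ncgen insubT.
Qed.

Lemma mxeval_word P : (size P <= m.+1)%N -> ev (nword K m P) = mxword T m.+1 P.
Proof.
elim: P => //= p ps IHP lt_m.
by rewrite IHP ?(ltnW lt_m) // mxeval_desc.
Qed.

Lemma entry_sum k (I : Type) (s : seq I) (c : I -> K) (M : I -> 'M[K]_(tdim k)) x :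
  entry (\sum_(i <- s) c i *: M i) x = \sum_(i <- s) c i * entry (M i) x.
Proof.
elim: s => [|i s IHs]; first by rewrite !big_nil /entry mulmx0 mul0mx mxE.
rewrite !big_cons -IHs /entry mulmxDr mulmxDl -scalemxAr -scalemxAl.
by rewrite mxE [X in X + _]mxE.
Qed.

Lemma entry0 k x : entry (0 : 'M[K]_(tdim k)) x = 0.
Proof. by rewrite /entry mulmx0 mul0mx mxE. Qed.

End Word.

Unset Implicit Arguments.

Theorem mainTheorem5 (K : closedFieldType) (charK0 : [pchar K] =i pred0)
  (n : nat) (hn : (2 <= n)%N) (q : K) (hq : n.-primitive_root q)
  (sq : K) (hsq : sq ^+ 2 = q) (r : 'I_n) (k : nat) (hk : (2 <= k)%N) :
  let lambda := q ^ (- (r * r.+1)%:Z) in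
  let xi := - (sq + sq^-1) in
  let T (j : 'I_k.-1) : 'M[K]_(tdim k) :=
    sq *: (lambda^-1 *: RcheckI q n r k j.+1 - 1%:M) in
  exists pi : ncterm K k.-1 -> 'M[K]_(tdim k),
    [/\ TL_hom xi pi,
        (forall P, isDnEnd q r (pi P)),
        (forall j : 'I_k.-1, pi (NGen j) = T j) &
        TL_inj xi pi].
Proof.
case: k hk => // m _; rewrite -[m.+1.-1]/m => lambda xi T.
have n_neq0 : n%:R != 0 :> K by move/pcharf0P: charK0 ->; rewrite -lt0n ltnW.
(* S extends T to all sizes and indices, as the inductions on the number of strands require. *)
pose S k' a : 'M[K]_(tdim k') := sq *: (lambda^-1 *: RcheckI q n r k' a.+1 - 1%:M).
have S_rec : forall k' a, a != k' -> S k'.+2 a = S k'.+1 a *t 1%:M :=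
  @TL_mx_rec K n q sq r.
have S_last := @TL_mx_last K n q sq r hq n_neq0 hn hsq.
have S_rhoT := @TL_mx_rhoT K n q sq r hq n_neq0 hn hsq.
have phi0 := cap_coef_neq0 r hq hn hsq.
have ups0 := cup_coef_neq0 r hq hn.
have loop := loop_value r hq hn hsq.
have zz := zigzag_value r hq hn hsq.
have mxTL P Q : TL_eq xi P Q -> mxeval T P = mxeval T Q.
  apply: mxeval_TL_eq => [i j lt_ij|i j eq_j|i j eq_j|i].
  - have lt_j : (j.+1 < m.+1)%N by rewrite ltnS.
    exact: (T_comm S_rec S_last lt_ij lt_j).
  - by rewrite /T eq_j; apply: (T_up S_rec S_last zz); rewrite ltnS -eq_j.
  - by rewrite /T eq_j; apply: (T_down S_rec S_last zz); rewrite ltnS -eq_j.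
  - by apply: (T_sq S_rec S_last loop); rewrite ltnS.
exists (mxeval T); split=> //.
- move=> P x; elim: P => [j|c|P IHP Q IHQ|P IHP Q IHQ];
    rewrite [mxeval _ _]/=.
  + by apply: S_rhoT; rewrite ltnS.
  + by rewrite scalar_mxC.
  + by rewrite mulmxDl mulmxDr IHP IHQ.
  + by rewrite -mulmxA IHQ mulmxA IHP mulmxA.
move=> P Q eqPQ A t relt.
have [c spanP] := all_spanned xi P; have [c' spanQ] := all_spanned xi Q.
(* Equal matrices and the independence of the Catalan words over V^(x)k force the two expansions to
   have the same coefficients. *)
have eqc : {in catalans m.+1, forall w, c w - c' w = 0}.
  apply: (@catalan_free K (fun w => c w - c' w)
            (fun w => entry (mxword S m.+1 w))).
    move=> w s; exact: (entry_word S_rec S_last phi0 ups0).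
  move=> s _; rewrite -entry_sum -(entry0 K m.+1 s); congr (entry _ s).
  have := eqPQ; rewrite (mxTL _ _ spanP) (mxTL _ _ spanQ) !mxeval_lincomb.
  move=> /eqP; rewrite -subr_eq0 -sumrB => /eqP diff0; rewrite -[RHS]diff0.
  rewrite big_seq [RHS]big_seq; apply: eq_bigr => w; rewrite mem_catalans.
  move=> /andP[_ /eqP sz_w]; rewrite scalerBl.
  by have -> := @mxeval_word K m S w (eq_leq sz_w).
rewrite spanP // spanQ // !lincombE big_seq [RHS]big_seq.
by apply: eq_bigr => w /eqc/eqP; rewrite subr_eq0 => /eqP->.
Qed.
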